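(* For incomplete information games and for each $L\in\{ATL_0,ATL_0^*\}$, the satisfaction relations satisfy $$\models^{L}_{ir}\ \subsetneq\ \models^{L}_{iF_2}\ \subsetneq\ \models^{L}_{iF_3}\ \subsetneq\ \cdots\ \subsetneq\ \models^{L}_{iF}\ \subsetneq\ \models^{L}_{iR}.$$ That is: $\models^{L}_{ir}\subsetneq\models^{L}_{iF_2}$; for every $k\ge 2$, $\models^{L}_{iF_k}\subsetneq\models^{L}_{iF_{k+1}}$ and $\models^{L}_{iF_k}\subsetneq\models^{L}_{iF}$; and $\models^{L}_{iF}\subsetneq\models^{L}_{iR}$.
   Context: A concurrent game structure with incomplete information (iCGS) with $n$ players is $\mathcal G=(\mathrm{States},\mathrm{Agt},\mathrm{Act},\mathrm{Mov},\mathrm{Tab},(\sim_j)_{1\le j\le n})$ with $\mathrm{States}$ a finite non-empty set, $\mathrm{Agt}=\{1,\dots,n\}$ non-empty, $\mathrm{Act}$ a finite non-empty set, $\mathrm{Mov}:\mathrm{States}\times\mathrm{Agt}\to 2^{\mathrm{Act}}\setminus\{\emptyset\}$ the legal actions, $\mathrm{Tab}(s,(a_1,\dots,a_n))\in\mathrm{States}$ defined for every state $s$ and all $(a_1,\dots,a_n)$ with $a_j\in\mathrm{Mov}(s,j)$ (such tuples are called moves), and each $\sim_j$ an equivalence relation on $\mathrm{States}$ such that $s\sim_j s'$ implies $\mathrm{Mov}(s,j)=\mathrm{Mov}(s',j)$. $[s]_j$ is the $\sim_j$-class (observation set) of $s$. An iCGM is $\mathcal M=(\mathcal G,\pi)$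 with $\pi:\mathrm{States}\to 2^{\mathrm{Prop}}$, where $\mathrm{Prop}$ is a finite set of propositions. An outcome is an infinite sequence of states in which each consecutive pair is connected by some move; a history is a non-empty finite prefix of an outcome; the history $s_0\cdots s_l$ induces for player $j$ the observation history $[s_0]_j\cdots[s_l]_j$. A perfect recall strategy ($Y=R$) for player $j$ maps each observation history of player $j$ to an action legal for $j$ in its last observation set. It is memoryless ($Y=r$) if it depends only on the last observation set. It is a $k$-memory strategy ($Y=F_k$, $k\ge1$) if there is a deterministic finite-state transducer with a set $M$ of $k$ memory states, initial state $m_0\in M$, input alphabet the observation sets of $j$, transition function $T$ and output function $G$ (with $T(m,o)\in M$ and $G(m,o)\in\mathrm{Act}$) such that on each observation history $o_0\cdots o_l$ the strategy plays $G(m_l,o_l)$, where $m_{i+1}=T(m_i,o_i)$. It is a finite-memory strategy ($Y=F$) if it is $k$-memory for some $k\ge1$. $\mathrm{Strat}^Y_j$ denotes the set of strategies of type $Y$ for player $j$; memoryless strategies are the same as 1-memory strategies. $\mathrm{Out}_{\mathcal G}(s,\sigma_A)$ is the set of outcomes from $s$ that are possible when each $a\in A$ follows $\sigma_a$ (the remaining players choosing arbitrary legal actions). $ATL_0^*$ consists of the formulas $\langle\!\langle A\rangle\!\rangle\varphi$ with $A\subseteq\mathrm{Agt}$ and $\varphi$ an LTL formula over $\mathrm{Prop}$ (built from propositions, $\neg,\vee,\mathbf X,\mathbf U$, evaluated on infinite paths as usual). $ATL_0$ consists of the formulas $\langle\!\langle A\rangle\!\rangle\mathbf X\varphi_1$,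 $\langle\!\langle A\rangle\!\rangle\mathbf G\varphi_1$, $\langle\!\langle A\rangle\!\rangle(\varphi_1\mathbf U\varphi_2)$ with $\varphi_1,\varphi_2$ Boolean combinations of propositions. ($\mathbf F\varphi=\top\mathbf U\varphi$, $\mathbf G\varphi=\neg\mathbf F\neg\varphi$.) $\mathcal M,s\models_{iY}\langle\!\langle A\rangle\!\rangle\varphi$ holds iff there are strategies $(\sigma_a)_{a\in A}\in\prod_{a\in A}\mathrm{Strat}^Y_a$ such that for every $a\in A$, every $s'\sim_a s$ and every $\rho\in\mathrm{Out}_{\mathcal G}(s',\sigma_A)$, $\rho$ satisfies $\varphi$. $\models^{L}_{iY}$ is regarded as the set of triples $(\mathcal M,s,\psi)$ with $\mathcal M$ an iCGM (over any finite $\mathrm{Agt}$ and $\mathrm{Prop}$), $s$ a state, $\psi$ an $L$ formula and $\mathcal M,s\models_{iY}\psi$; inclusion refers to these sets. *)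

(* Defs.v *)
From mathcomp Require Import all_boot.

Set Implicit Arguments.
Unset Strict Implicit.
Unset Printing Implicit Defensive.

Definition move (n : nat) (St A : finType) (mov : St -> 'I_n -> {set A})
    (s : St) :=
  {m : {ffun 'I_n -> A} | [forall j, m j \in mov s j]}.

(* The players 1, ..., n are represented by the elements of 'I_n. *)
Record iCGS := ICGS {
  nplayers : nat;
  state : finType;
  act : finType;
  mov : state -> 'I_nplayers -> {set act};
  tab : forall s : state, move mov s -> state;
  sim : 'I_nplayers -> rel state;
  nplayers_gt0 : 0 < nplayers;
  state_gt0 : 0 < #|state|;
  act_gt0 : 0 < #|act|;
  mov_gt0 : forall s j, 0 < #|mov s j|;
  sim_equiv : forall j,
    [/\ reflexive (sim j), symmetric (sim j) & transitive (sim j)];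
  sim_mov : forall j s s', sim j s s' -> mov s j = mov s' j
}.

Record iCGM := ICGM {
  game :> iCGS;
  ap : finType;
  label : state game -> {set ap}
}.

Section Strategies.
Variable G : iCGS.

Definition obs (j : 'I_(nplayers G)) (s : state G) : {set state G} :=
  finset (sim j s).

Definition outcome (rho : nat -> state G) : Prop :=
  forall i, exists m : move (@mov G) (rho i), rho i.+1 = tab m.

Definition history (h : seq (state G)) : Prop :=
  exists2 rho, outcome rho & exists l, h = mkseq rho l.+1.

Definition obs_history (j : 'I_(nplayers G)) (oh : seq {set state G}) : Prop :=
  exists2 h, history h & oh = map (obs j) h.

(* Strategies and transducers are total functions on sequences of sets of     *)
(* states; their values off the observation histories (resp. observation      *)
(* sets) of the player are unconstrained and never used. A nonempty           *)
(* observation history is written rcons oh o, with o its last observation set.*)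
Definition strategy := seq {set state G} -> act G.

Definition perfect_recall (j : 'I_(nplayers G)) (f : strategy) : Prop :=
  forall oh o, obs_history j (rcons oh o) ->
  forall s, s \in o -> f (rcons oh o) \in mov s j.

Definition memoryless (j : 'I_(nplayers G)) (f : strategy) : Prop :=
  forall oh oh' o, obs_history j (rcons oh o) -> obs_history j (rcons oh' o) ->
  f (rcons oh o) = f (rcons oh' o).

Record transducer (k : nat) := Transducer {
  init : 'I_k;
  trans : 'I_k -> {set state G} -> 'I_k;
  output : 'I_k -> {set state G} -> act G
}.

(* After the observations oh = o_0 ... o_(l-1), the memory state is           *)
(* m_l = foldl (trans t) (init t) oh.                                         *)
Definition implements (j : 'I_(nplayers G)) k (t : transducer k)
    (f : strategy) : Prop :=
  forall oh o, obs_history j (rcons oh o) ->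
  f (rcons oh o) = output t (foldl (trans t) (init t) oh) o.

Definition k_memory (j : 'I_(nplayers G)) (k : nat) (f : strategy) : Prop :=
  exists t : transducer k, implements j t f.

End Strategies.

Inductive strategy_type :=
  | Recall
  | Memoryless
  | Memory of nat
  | FiniteMemory.

Definition Strat (G : iCGS) (Y : strategy_type) (j : 'I_(nplayers G))
    (f : strategy G) : Prop :=
  perfect_recall j f /\
  match Y with
  | Recall => True
  | Memoryless => memoryless j f
  | Memory k => k_memory j k f
  | FiniteMemory => exists2 k, 1 <= k & k_memory j k f
  end.

(* Only the components sigma a with a \in A of a profile are relevant. *)
Definition Out (G : iCGS) (s : state G) (A : {set 'I_(nplayers G)})
    (sigma : 'I_(nplayers G) -> strategy G) (rho : nat -> state G) : Prop :=
  rho 0 = s /\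
  forall i, exists m : move (@mov G) (rho i),
    (forall a, a \in A -> val m a = sigma a (map (obs a) (mkseq rho i.+1))) /\
    rho i.+1 = tab m.

Inductive ltl (P : Type) :=
  | Atom of P
  | Neg of ltl P
  | Or of ltl P & ltl P
  | Next of ltl P
  | Until of ltl P & ltl P.

(* Truth has no constructor of its own: in F phi = (true U phi) it is written *)
(* phi \/ ~ phi, which makes sense also when there is no proposition.         *)
Definition Eventually P (phi : ltl P) := Until (Or phi (Neg phi)) phi.
Definition Always P (phi : ltl P) := Neg (Eventually (Neg phi)).

Fixpoint holds (M : iCGM) (rho : nat -> state M) (phi : ltl (ap M)) : Prop :=
  match phi with
  | Atom p => p \in label (rho 0)
  | Neg phi1 => ~ holds rho phi1
  | Or phi1 phi2 => holds rho phi1 \/ holds rho phi2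
  | Next phi1 => holds (fun i => rho i.+1) phi1
  | Until phi1 phi2 =>
      exists2 k, holds (fun i => rho (k + i)) phi2 &
        forall l, l < k -> holds (fun i => rho (l + i)) phi1
  end.

(* The formula <<coalition>> body; n is the number of players. *)
Record atl_star0 (n : nat) (P : Type) := Strategic {
  coalition : {set 'I_n};
  body : ltl P
}.

Fixpoint boolean_comb P (phi : ltl P) : bool :=
  match phi with
  | Atom _ => true
  | Neg phi1 => boolean_comb phi1
  | Or phi1 phi2 => boolean_comb phi1 && boolean_comb phi2
  | Next _ | Until _ _ => false
  end.

Inductive atl0_body P : ltl P -> Prop :=
  | ATL0_X phi1 : boolean_comb phi1 -> atl0_body (Next phi1)
  | ATL0_G phi1 : boolean_comb phi1 -> atl0_body (Always phi1)
  | ATL0_U phi1 phi2 : boolean_comb phi1 -> boolean_comb phi2 ->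
      atl0_body (Until phi1 phi2).

Inductive logic := ATL0 | ATL0_star.

Definition in_logic (L : logic) n P (psi : atl_star0 n P) : Prop :=
  match L with
  | ATL0 => atl0_body (body psi)
  | ATL0_star => True
  end.

Definition satisfies (Y : strategy_type) (M : iCGM) (s : state M)
    (psi : atl_star0 (nplayers M) (ap M)) : Prop :=
  let A := coalition psi in
  exists sigma : 'I_(nplayers M) -> strategy M,
    (forall a, a \in A -> Strat Y a (sigma a)) /\
    forall a, a \in A -> forall s', sim a s' s ->
    forall rho, Out s' A sigma rho -> holds rho (body psi).

Record triple := Triple {
  model : iCGM;
  point : state model;
  formula : atl_star0 (nplayers model) (ap model)
}.

Definition sat_rel (L : logic) (Y : strategy_type) (t : triple) : Prop :=
  in_logic L (formula t) /\ satisfies Y (point t) (formula t).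

(* The universe of triple is too high for the type set of classical_sets. *)
Definition strictly_included (R S : triple -> Prop) : Prop :=
  (forall t, R t -> S t) /\ ~ (forall t, S t -> R t).

(* Main.v *)
Require Import Defs.
From HB Require Import structures.
From mathcomp Require Import all_boot.
From mathcomp Require Import zify.

(** Strictness is witnessed by formulas <<A>> G p.

    A blind player who, after a start signal, must play k times [false] and
    then once [true] needs k + 1 memory states.

    For finite memory against perfect recall, two players receive words over
    {A, B, C} and answer one bit after each letter. The environment secretly
    chooses the pair of words, among pairs that a finite automaton can generate:
    equal words A^i C^m B^j, or A^(i+1) C^m B^(j+1) for player 1 against
    A^i C^(m+2) B^j for player 2. In both cases the answers after B's must
    agree, while C^m (m > 0) must be answered [true] and A^i C^m (i, m > 0)
    [false]. The answer "#A <= #B" meets these requirements. Conversely, they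
    force A^i B^j, for i >= j > 0, to be answered by the truth value of i = j,
    which no finite transducer can do. *)

Set Implicit Arguments.
Unset Strict Implicit.
Unset Printing Implicit Defensive.

(** * Outcomes *)

(** The move [mv h] may depend on the whole history, so the recursion builds histories rather than
    states. Moves are compared through [val] because [rho i] and [last s (mkseq rho i.+1)], on which
    their types depend, are only propositionally equal. *)
Lemma outcome_from (G : iCGS) (s : state G)
    (mv : forall h : seq (state G), move (@mov G) (last s h)) :
  exists rho : nat -> state G, rho 0 = s /\
    forall i, exists m : move (@mov G) (rho i),
      val m = val (mv (mkseq rho i.+1)) /\ rho i.+1 = tab m.
Proof.
pose H := fix H i := if i is i'.+1 then rcons (H i') (tab (mv (H i')))
  else [:: s].
pose rho i := last s (H i).
have HE i : H i = mkseq rho i.+1.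
  elim: i => [|i IHi] //.
  by rewrite mkseqS -IHi; congr rcons; rewrite /rho /= last_rcons.
exists rho; split=> // i; exists (mv (H i)).
by rewrite -HE; split=> //; rewrite /rho /= last_rcons.
Qed.

Lemma legal_move (G : iCGS) (s : state G) : move (@mov G) s.
Proof.
exists [ffun j => xchoose (elimT card_gt0P (mov_gt0 s j))].
by apply/forallP=> j; rewrite ffunE; apply: xchooseP.
Qed.

Lemma outcome_exists (G : iCGS) (s : state G) :
  exists2 rho : nat -> state G, outcome rho & rho 0 = s.
Proof.
have [rho [rho0 rhoS]] := outcome_from (fun h => legal_move (last s h)).
by exists rho => // i; have [m [_ ->]] := rhoS i; exists m.
Qed.

Lemma Out_obs_history (G : iCGS) (s : state G) A sigma rho j i :
  Out s A sigma rho -> obs_history j (map (obs j) (mkseq rho i.+1)).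
Proof.
case=> _ rhoS; exists (mkseq rho i.+1) => //; exists rho; last by exists i.
by move=> l; have [m [_ ->]] := rhoS l; exists m.
Qed.

Lemma holds_always (M : iCGM) (rho : nat -> state M) (p : ap M) :
  holds rho (Always (Atom p)) <-> forall i, p \in label (rho i).
Proof.
split=> [H i|H [i] /=]; last by rewrite addn0 => /(_ (H i)).
apply/negPn/negP=> Hi; apply: H; exists i => /=.
  by rewrite addn0; apply/negP.
(* The guard is truth written as an excluded middle; it is settled by the boolean membership
   test. *)
by move=> l _; case: (p \in label (rho (l + 0))); [right => - []|left]; move.
Qed.

(** * Inclusions *)

Lemma satisfies_mono Y Y' (M : iCGM) (s : state M) psi :
    (forall j f, @Strat M Y j f -> @Strat M Y' j f) ->
  satisfies Y s psi -> satisfies Y' s psi.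
Proof.
by move=> YY' [sigma [Hs Hw]]; exists sigma; split=> // a aA; apply/YY'/Hs.
Qed.

(** Formulas [<<A>> G p] lie in both logics, so one witness serves for either [L]. *)
Lemma strict_inclusion L Y Y' :
    (forall (G : iCGS) (j : 'I_(nplayers G)) f, Strat Y j f -> Strat Y' j f) ->
    (exists (M : iCGM) (s : state M) A (p : ap M),
      satisfies Y' s (Strategic A (Always (Atom p))) /\
      ~ satisfies Y s (Strategic A (Always (Atom p)))) ->
  strictly_included (sat_rel L Y) (sat_rel L Y').
Proof.
move=> sYY' [M [s [A [p [sat nsat]]]]]; split=> [[N q psi] [HL]|].
  by move=> Hsat; split=> //; exact: satisfies_mono (sYY' N) Hsat.
move=> /(_ (Triple s (Strategic A (Always (Atom p))))) []; last by [].
by split=> //; case: L => //; apply: ATL0_G.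
Qed.

Section StratInclusion.
Variables (G : iCGS) (j : 'I_(nplayers G)) (f : strategy G).

Lemma Strat_memoryless1 : Strat Memoryless j f -> Strat (Memory 1) j f.
Proof.
case=> Hf ml; split=> //.
exists (Transducer ord0 (fun _ _ => ord0) (fun _ o => f [:: o])) => oh o Ho.
(* The one-letter sequence [[:: o]] is itself an observation history, since some outcome starts in
   every state. *)
apply: (ml oh [::]) => //; case: Ho => h [rho _ [l ->]].
rewrite mkseqS map_rcons => /rcons_inj[_ ->].
have [rho' Hrho' <-] := outcome_exists (rho l).
by exists [:: rho' 0] => //; exists rho' => //; exists 0.
Qed.

Lemma Strat_memoryS k : Strat (Memory k) j f -> Strat (Memory k.+1) j f.
Proof.
case=> Hf [t Ht]; split=> //.
pose w := widen_ord (leqnSn k).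
(* The additional memory state is decoded as [init t], but it is never reached. *)
pose v (q : 'I_k.+1) : 'I_k := insubd (init t) (val q).
have wK : cancel w v.
  by move=> q; apply: val_inj; rewrite /v val_insubd /= ltn_ord.
exists (Transducer (w (init t)) (fun q o => w (trans t (v q) o))
  (fun q o => output t (v q) o)) => oh o /Ht -> /=.
congr (output t _ o); elim: oh (init t) => [|x oh IH] q /=; first by rewrite wK.
by rewrite wK.
Qed.

Lemma Strat_memory_finite k : Strat (Memory k) j f -> Strat FiniteMemory j f.
Proof.
case=> Hf [t Ht]; split=> //; exists k; last by exists t.
(* An initial state in ['I_k] forces [k] to be positive. *)
exact: leq_ltn_trans (ltn_ord (init t)).
Qed.

Lemma Strat_recall Y : Strat Y j f -> Strat Recall j f.
Proof. by case. Qed.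

End StratInclusion.

(** * Games in which all actions are always legal *)

Section FreeGame.
Variables (n : nat) (St Act : finType) (s0 : St) (a0 : Act).
Variables (tabf : St -> {ffun 'I_n.+1 -> Act} -> St).
Variables (ob : 'I_n.+1 -> St -> St) (safe : pred St).

Definition free_mov (s : St) (j : 'I_n.+1) : {set Act} := [set: Act].
Definition free_tab s (m : move free_mov s) : St := tabf s (val m).
Definition free_sim (j : 'I_n.+1) : rel St := fun s s' => ob j s == ob j s'.

Lemma free_state_gt0 : 0 < #|St|.
Proof. by apply/card_gt0P; exists s0. Qed.

Lemma free_act_gt0 : 0 < #|Act|.
Proof. by apply/card_gt0P; exists a0. Qed.

Lemma free_mov_gt0 s j : 0 < #|free_mov s j|.
Proof. by rewrite cardsT free_act_gt0. Qed.

Lemma free_sim_equiv j :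
  [/\ reflexive (free_sim j), symmetric (free_sim j) & transitive (free_sim j)].
Proof.
by split=> [s|s s'|s s' s'']; rewrite /free_sim // => /eqP -> /eqP ->.
Qed.

Lemma free_sim_mov j s s' : free_sim j s s' -> free_mov s j = free_mov s' j.
Proof. by []. Qed.

Definition free_game : iCGS :=
  ICGS free_tab (ltn0Sn n) free_state_gt0 free_act_gt0 free_mov_gt0
    free_sim_equiv free_sim_mov.

Definition free_model : iCGM :=
  @ICGM free_game unit (fun s : St => [set _ | safe s]).

Lemma free_legal (s : St) (m : {ffun 'I_n.+1 -> Act}) :
  [forall j, m j \in free_mov s j].
Proof. by apply/forallP=> j; rewrite inE. Qed.

Lemma mem_free_obs (j : 'I_n.+1) (s s' : St) :
  (s' \in @obs free_game j s) = (ob j s == ob j s').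
Proof. by rewrite inE. Qed.

Lemma free_obsP (j : 'I_n.+1) (s s' : St) :
  ob j s = ob j s' -> @obs free_game j s = @obs free_game j s'.
Proof. by move=> e; apply/setP=> x; rewrite !mem_free_obs e. Qed.

Lemma free_perfect_recall (j : 'I_n.+1) f : @perfect_recall free_game j f.
Proof. by move=> oh o _ s _; rewrite inE. Qed.

Lemma free_OutP s (A : {set 'I_n.+1}) sigma rho :
  @Out free_game s A sigma rho <->
  rho 0 = s /\ forall i, exists m : {ffun 'I_n.+1 -> Act},
    (forall a, a \in A ->
      m a = sigma a (map (@obs free_game a) (mkseq rho i.+1))) /\
    rho i.+1 = tabf (rho i) m.
Proof.
split=> -[rho0 rhoS]; split=> // i; have [m [mA ->]] := rhoS i.
  by exists (val m).
by exists (exist _ m (free_legal _ m)).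
Qed.

(** Lets the players outside [A] follow any prescribed history-dependent plan against [sigma]. *)
Lemma free_Out_from s (A : {set 'I_n.+1}) sigma
    (mv : seq St -> {ffun 'I_n.+1 -> Act}) :
    (forall h a, a \in A -> mv h a = sigma a (map (@obs free_game a) h)) ->
  exists2 rho, @Out free_game s A sigma rho &
    forall i, rho i.+1 = tabf (rho i) (mv (mkseq rho i.+1)).
Proof.
move=> mvA.
have [rho [rho0 rhoS]] := @outcome_from free_game s
  (fun h => exist _ (mv h) (free_legal _ (mv h))).
exists rho => [|i]; last by have [m [/= <- ->]] := rhoS i.
apply/free_OutP; split=> // i; exists (mv (mkseq rho i.+1)); split.
  by move=> a /mvA.
by have [m [/= <- ->]] := rhoS i.
Qed.

Lemma free_satisfies Y (s : St) (A : {set 'I_n.+1}) :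
  @satisfies Y free_model s (Strategic A (Always (Atom (P := unit) tt))) <->
  exists sigma : 'I_n.+1 -> strategy free_game,
    (forall a, a \in A -> @Strat free_game Y a (sigma a)) /\
    forall a, a \in A -> forall s', ob a s' = ob a s ->
    forall rho, @Out free_game s' A sigma rho -> forall i, safe (rho i).
Proof.
split=> -[sigma [Hs Hw]]; exists sigma; split=> // a aA s' Hs' rho Hrho.
  move=> i; have := Hw a aA s' (introT eqP Hs') rho Hrho.
  by move/(@holds_always free_model) => /(_ i); rewrite inE.
apply/(@holds_always free_model) => i; rewrite inE.
exact: (Hw a aA s' (elimT eqP Hs') rho Hrho).
Qed.

End FreeGame.

(** The memory has read all observations but the last one, to which [output] is applied. The default
    [set0] is met only on the empty sequence. *)
Definition run G k (t : transducer G k) : strategy G :=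
  fun oh => output t (foldl (trans t) (init t) (take (size oh).-1 oh))
                     (last set0 oh).

Lemma run_rcons G k (t : transducer G k) oh o :
  run t (rcons oh o) = output t (foldl (trans t) (init t) oh) o.
Proof. by rewrite /run size_rcons last_rcons -cats1 take_size_cat. Qed.

Lemma ord_pigeonhole K n (q : nat -> 'I_K) :
  K <= n -> exists i j, [/\ i < j, j <= n & q i = q j].
Proof.
move=> Kn; pose q' (i : 'I_n.+1) := q i.
have /injectivePn[x [y xy qxy]] : ~~ injectiveb q'.
  apply/negP=> /injectiveP /leq_card; rewrite !card_ord => /(leq_trans)/(_ Kn).
  by rewrite ltnn.
have [lt|lt|/val_inj e] := ltngtP x y; last by rewrite e eqxx in xy.
  by exists x, y; split=> //; rewrite -ltnS ltn_ord.
by exists y, x; split=> //; rewrite -ltnS ltn_ord.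
Qed.

(** * Games requiring k + 1 memory states *)

Section ChainGame.
Variable k : nat.

Definition chain_state : finType := option 'I_k.+2.

(** [Some ord0] is the start signal and [None] the losing sink. The next [k] states demand [false]
    and [ord_max] demands [true], after which [ordS] wraps around to the start. *)
Definition chain_tab (s : chain_state) (m : {ffun 'I_1 -> bool}) :
    chain_state :=
  if s is Some i then
    if (i == ord0) || ((i == ord_max) == m ord0) then Some (ordS i) else None
  else None.

Definition chain_ob (j : 'I_1) (s : chain_state) : chain_state :=
  if s == Some ord0 then Some ord0 else None.

Definition chain_game : iCGS :=
  free_game (None : chain_state) true chain_tab chain_ob.

Definition chain_model : iCGM :=
  free_model (None : chain_state) true chain_tab chain_ob (fun s => s != None).

Definition chain_trans (q : 'I_k.+1) (o : {set chain_state}) : 'I_k.+1 :=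
  if Some ord0 \in o then ord0 else ordS q.

Definition chain_transducer : transducer chain_game k.+1 :=
  @Transducer chain_game k.+1 ord0 chain_trans (fun q _ => q == ord_max).

Lemma chain_obs0 (j : 'I_1) (s : chain_state) :
  (Some ord0 \in @obs chain_game j s) = (s == Some ord0).
Proof.
by rewrite mem_free_obs /chain_ob eqxx; case: (s =P _); rewrite ?eqxx.
Qed.

Lemma chain_pos :
  @satisfies (Memory k.+1) chain_model (Some ord0)
    (Strategic [set: 'I_1] (Always (Atom (P := unit) tt))).
Proof.
apply/free_satisfies; exists (fun _ => run chain_transducer).
split=> [a _|a _ s'].
  split; first exact: free_perfect_recall.
  by exists chain_transducer => oh o _; rewrite run_rcons.
rewrite /chain_ob eqxx; case: eqP => // -> _ rho /free_OutP[rho0 rhoS] i.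
(* Invariant: past the start, the memory before reading the current state is one less than its
   index. At the start every answer is accepted, so nothing is asked of the memory. *)
suff [p -> _]: exists2 p, rho i = Some p & 0 < p ->
    p = (foldl chain_trans ord0
      (map (@obs chain_game ord0) (mkseq rho i))).+1 :> nat.
  by [].
elim: i => [|i [p rhoi Hp]]; first by exists ord0.
have [m [mE ->]] := rhoS i; move: (mE ord0 (in_setT _)).
rewrite !mkseqS !map_rcons run_rcons foldl_rcons /= rhoi /= => ->.
set q := foldl _ _ _ in Hp *.
rewrite /chain_trans chain_obs0 /=.
have [->|p0] := eqVneq p ord0; first by exists (ordS ord0); rewrite ?eqxx.
have {}Hp : p = q.+1 :> nat by apply: Hp; rewrite lt0n.
have -> : (q == ord_max) = (p == ord_max) by rewrite -!val_eqE /= Hp.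
rewrite eqxx; exists (ordS p) => //=.
rewrite ifF; last by apply/negbTE; apply: contraNneq p0 => -[->].
(* From the last state the chain returns to the start, where the invariant is vacuous. *)
have := ltn_ord p; rewrite leq_eqVlt => /orP[/eqP->|lt]; first by rewrite modnn.
by rewrite /= !modn_small //; lia.
Qed.

Lemma chain_neg :
  ~ @satisfies (Memory k) chain_model (Some ord0)
      (Strategic [set: 'I_1] (Always (Atom (P := unit) tt))).
Proof.
case/free_satisfies => sigma [/(_ ord0 (in_setT _)) [_ [t Ht]] Hw].
pose mv h : {ffun 'I_1 -> bool} :=
  [ffun j => sigma j (map (@obs chain_game j) h)].
have [|rho Hrho rhoS] := @free_Out_from _ _ _ (None : chain_state) true
    chain_tab chain_ob (Some ord0) setT sigma mv.
  by move=> h a _; rewrite ffunE.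
have {}Hw i : rho i != None.
  exact: (Hw ord0 (in_setT _) (Some ord0) erefl rho Hrho).
have rho0 : rho 0 = Some ord0 by case: Hrho.
have rhoE i : i <= k.+1 -> rho i = Some (inord i).
  elim: i => [|i IHi] lei.
    by rewrite rho0; congr Some; apply: val_inj; rewrite /= inordK.
  have := Hw i.+1; rewrite rhoS (IHi (ltnW lei)) /=; case: ifP => // _ _.
  by congr Some; apply: val_inj; rewrite /= !inordK ?modn_small //; lia.
pose o1 := @obs chain_game ord0 None.
have obsE i : i <= k -> @obs chain_game ord0 (rho i.+1) = o1.
  move=> lei; apply: free_obsP; rewrite rhoE // /chain_ob ifF //.
  by apply/eqP=> -[] /(congr1 val) /=; rewrite inordK.
(* All states after the start look like [o1], so [q i] is the memory with which the answer in state
   [i.+1] of the chain is computed. *)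
pose q i := iter i (fun q => trans t q o1)
  (trans t (init t) (@obs chain_game ord0 (rho 0))).
have qE i : i <= k -> foldl (trans t) (init t)
    (map (@obs chain_game ord0) (mkseq rho i.+1)) = q i.
  elim: i => [|i IHi] lei //.
  by rewrite mkseqS map_rcons foldl_rcons IHi ?(ltnW lei) // obsE // ltnW.
have outE i : i <= k -> output t (q i) o1 = (i == k).
  move=> lei; have := Hw i.+2; rewrite rhoS rhoE // /chain_tab ffunE.
  have := @Out_obs_history chain_game _ _ _ _ ord0 i.+1 Hrho.
  rewrite mkseqS map_rcons => /Ht ->.
  rewrite qE // obsE //; have -> : (inord i.+1 == ord0 :> 'I_k.+2) = false.
    by apply/eqP=> /(congr1 val); rewrite /= inordK.
  have -> : (inord i.+1 == ord_max :> 'I_k.+2) = (i == k).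
    by rewrite -val_eqE /= inordK.
  by case: (i == k); case: (output _ _ _).
have [i [j [ij jk qij]]] := ord_pigeonhole q (leqnn k).
(* Reading [k - j] further copies of [o1] moves the repetition to [q k], where [true] is due, and to
   an earlier index, where [false] is due. *)
have := outE (k - j + j); rewrite subnK // eqxx => /(_ (leqnn k)).
have -> : q k = q (k - j + i) by rewrite /q iterD -/(q i) qij -iterD subnK.
rewrite outE; last by lia.
by move=> /eqP; lia.
Qed.

End ChainGame.

(** * A game requiring infinite memory *)

(* The two letters of a state are those shown to players 1 and 2. CC0 is
   reached without any A, CC1 on equal words, CC2 on shifted words. Bad, which
   is entered after a wrong pair of answers, and Sink, which punishes illegal
   choices of the environment, may show any letter but must not look like
   Start: then the players know that the game begins in Start. *)
Inductive match_state :=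
  | Start | AA | AC | CC0 | CC1 | CC2 | BC | BB | Sink | Bad.

Definition match_code (s : match_state) : 'I_10 :=
  match s with
  | Start => @Ordinal 10 0 isT | AA => @Ordinal 10 1 isT
  | AC => @Ordinal 10 2 isT | CC0 => @Ordinal 10 3 isT
  | CC1 => @Ordinal 10 4 isT | CC2 => @Ordinal 10 5 isT
  | BC => @Ordinal 10 6 isT | BB => @Ordinal 10 7 isT
  | Sink => @Ordinal 10 8 isT | Bad => @Ordinal 10 9 isT
  end.

Definition match_decode (i : 'I_10) : match_state :=
  nth Start [:: Start; AA; AC; CC0; CC1; CC2; BC; BB; Sink; Bad] i.

Lemma match_codeK : cancel match_code match_decode.
Proof. by case. Qed.

HB.instance Definition _ := Finite.copy match_state (can_type match_codeK).

Definition player1 : 'I_3 := @Ordinal 3 0 isT.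
Definition player2 : 'I_3 := @Ordinal 3 1 isT.
Definition environment : 'I_3 := @Ordinal 3 2 isT.
Definition team : {set 'I_3} := [set player1; player2].

Definition match_next (s s' : match_state) : bool :=
  match s, s' with
  | Start, (AA | AC | CC0)
  | AA, (AA | AC | CC1 | BB)
  | CC0, CC0
  | CC1, (CC1 | BB)
  | (AC | CC2), (CC2 | BC)
  | (BC | BB), BB => true
  | _, _ => false
  end.

Definition match_ok (s : match_state) (x y : bool) : bool :=
  match s with
  | CC0 => x && y
  | CC1 => ~~ x && ~~ y
  | BC | BB => x == y
  | Bad => false
  | _ => true
  end.

(** All players share one action type: an action pairs an answer, read from the team, with a next
    state, read from the environment. *)
Definition match_tab (s : match_state)
    (m : {ffun 'I_3 -> bool * match_state}) :=
  if match_ok s (m player1).1 (m player2).1 then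
    if match_next s (m environment).2 then (m environment).2 else Sink
  else Bad.

(** The letters A, B and C are represented by the states [AA], [BB] and [CC0], which makes
    [match_ob j] idempotent. *)
Definition match_ob (j : 'I_3) (s : match_state) : match_state :=
  match s with
  | Start => Start
  | AA => AA
  | AC => if j == player1 then AA else CC0
  | BC => if j == player1 then BB else CC0
  | BB => BB
  | _ => CC0
  end.

Definition match_game : iCGS := free_game Start (true, Sink) match_tab match_ob.

Definition match_model : iCGM :=
  free_model Start (true, Sink) match_tab match_ob (fun s => s != Bad).

Lemma match_obK (j : 'I_3) s : match_ob j (match_ob j s) = match_ob j s.
Proof. by case: s => //=; case: ifP. Qed.

Lemma match_obs_ob (j : 'I_3) (u : seq match_state) :
  map (@obs match_game j) (map (match_ob j) u) = map (@obs match_game j) u.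
Proof.
rewrite -map_comp; apply: eq_map => s /=; apply: free_obsP; exact: match_obK.
Qed.

Lemma count_obs (j : 'I_3) x h : match_ob j x = x ->
  count (fun o : {set match_state} => x \in o) (map (@obs match_game j) h) =
  count (fun s => match_ob j s == x) h.
Proof.
move=> xj; rewrite count_map; apply: eq_count => s /=.
by rewrite mem_free_obs xj.
Qed.

Definition match_strategy : strategy match_game := fun oh =>
  (count (fun o : {set match_state} => AA \in o) oh <=
   count (fun o : {set match_state} => BB \in o) oh, Sink).

(* a1, b1, a2, b2: the numbers of letters A and B seen by the two players. *)
Definition match_inv (s : match_state) (a1 b1 a2 b2 : nat) : bool :=
  match s with
  | Start | CC0 => [&& a1 == 0, b1 == 0, a2 == 0 & b2 == 0]
  | AA | CC1 => [&& a1 == a2, 0 < a1, b1 == 0 & b2 == 0]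
  | AC | CC2 => [&& a1 == a2.+1, b1 == 0 & b2 == 0]
  | BC => [&& a1 == a2.+1, b1 == 1 & b2 == 0]
  | BB => a1 + b2 == a2 + b1
  | Sink => true
  | Bad => false
  end.

(** In [BC] and [BB] the surplus of A over B is the same for both players, hence so are their
    answers. *)
Lemma match_inv_ok s a1 b1 a2 b2 :
  match_inv s a1 b1 a2 b2 -> match_ok s (a1 <= b1) (a2 <= b2).
Proof. by case: s => //=; lia. Qed.

(** [AC] gives player 1 an extra A, and [BC] makes up for it with an extra B. *)
Lemma match_inv_next s s' a1 b1 a2 b2 :
  match_inv s a1 b1 a2 b2 -> match_next s s' ->
  match_inv s' (a1 + (match_ob player1 s' == AA))
    (b1 + (match_ob player1 s' == BB)) (a2 + (match_ob player2 s' == AA))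
    (b2 + (match_ob player2 s' == BB)).
Proof.
by case: s; case: s' => //=; lia.
Qed.

Lemma match_pos :
  @satisfies Recall match_model Start
    (Strategic team (Always (Atom (P := unit) tt))).
Proof.
apply/free_satisfies; exists (fun _ => match_strategy).
split=> [a _|a _ s' /= Hs'].
  by split=> //; apply: free_perfect_recall.
move=> rho /free_OutP[rho0 rhoS] i.
pose c (j : 'I_3) x i := count (fun s => match_ob j s == x) (mkseq rho i.+1).
have cS j x l : c j x l.+1 = c j x l + (match_ob j (rho l.+1) == x).
  by rewrite /c mkseqS -cats1 count_cat /= addn0.
suff: match_inv (rho i) (c player1 AA i) (c player1 BB i)
    (c player2 AA i) (c player2 BB i).
  by apply: contraTneq => ->.
elim: i => [|i IHi].
  rewrite /c /= rho0; clear rho0; move: Hs'; case: s' => //=; by case: ifP.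
have [m [mE rhoE]] := rhoS i.
have stratE j : j \in team -> (m j).1 = (c j AA i <= c j BB i).
  by move=> /mE ->; rewrite -[LHS]/(count _ _ <= count _ _) !count_obs.
rewrite !cS rhoE /match_tab !stratE ?inE ?eqxx ?orbT // match_inv_ok //.
by case: ifP => // /(match_inv_next IHi).
Qed.

(** * Paths of the environment and the words observed along them *)

Definition eq_path i m j := nseq i AA ++ nseq m CC1 ++ nseq j BB.

Definition shift_path i m j := nseq i AA ++ AC :: nseq m CC2 ++ BC :: nseq j BB.

Definition word i m j := Start :: nseq i AA ++ nseq m CC0 ++ nseq j BB.

Lemma nseq_cat_cons T i (x : T) s : nseq i x ++ x :: s = nseq i.+1 x ++ s.
Proof. by elim: i => //= i ->. Qed.

Lemma path_nseq (T : Type) (e : rel T) x i s :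
  e x x -> path e x (nseq i x ++ s) = path e x s.
Proof. by move=> exx; elim: i => //= i ->; rewrite exx. Qed.

Lemma rcons_nseq T (x : T) i : rcons (nseq i x) x = nseq i.+1 x.
Proof. by elim: i => //= i ->. Qed.

Lemma last_nseqS T (x y : T) i : last x (nseq i.+1 y) = y.
Proof. by elim: i. Qed.

(** At least one A is asked for because [CC1] and [BB] cannot follow [Start]; words of C alone use
    [CC0] instead. *)
Lemma path_eq i m j : path match_next Start (eq_path i.+1 m j).
Proof.
rewrite /eq_path /= path_nseq //; case: m => [|m] /=; last rewrite path_nseq //;
  by case: j => //= j; rewrite -[nseq j BB]cats0 path_nseq.
Qed.

Lemma path_shift i m j : path match_next Start (shift_path i m j).
Proof.
have H x : match_next x AC ->
    path match_next x (AC :: nseq m CC2 ++ BC :: nseq j BB).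
  move=> /= ->; case: m => [|m] /=; last rewrite path_nseq //;
    by case: j => //= j; rewrite -[nseq j BB]cats0 path_nseq.
case: i => [|i]; first exact: H.
by rewrite -[path _ _ _]/(path match_next AA (nseq i AA ++ _)) path_nseq // H.
Qed.

Lemma path_blank m : path match_next Start (nseq m CC0).
Proof. by case: m => //= m; rewrite -[nseq m CC0]cats0 path_nseq. Qed.

Lemma word_eq p i m j : map (match_ob p) (Start :: eq_path i m j) = word i m j.
Proof. by rewrite /= !map_cat !map_nseq. Qed.

Lemma word_blank p m : map (match_ob p) (Start :: nseq m CC0) = word 0 m 0.
Proof. by rewrite /word /= cats0 map_nseq. Qed.

Lemma word_shift1 i m j :
  map (match_ob player1) (Start :: shift_path i m j) = word i.+1 m j.+1.
Proof.
by rewrite /= map_cat /= map_cat /= !map_nseq /= nseq_cat_cons.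
Qed.

Lemma word_shift2 i m j :
  map (match_ob player2) (Start :: shift_path i m j) = word i m.+2 j.
Proof.
rewrite /= map_cat /= map_cat /= !map_nseq /=.
by rewrite nseq_cat_cons.
Qed.

Lemma match_neg :
  ~ @satisfies FiniteMemory match_model Start
      (Strategic team (Always (Atom (P := unit) tt))).
Proof.
case/free_satisfies => sigma [Hsigma Hw].
have team1 : player1 \in team by rewrite !inE.
have team2 : player2 \in team by rewrite !inE.
pose F p u := (sigma p (map (@obs match_game p) u)).1.
have F_ob p u : F p (map (match_ob p) u) = F p u by rewrite /F match_obs_ob.
(* The environment can realise every legal path, so a winning team must answer correctly at its
   end. *)
have play p : path match_next Start p ->
    @obs_history match_game player1
      (map (@obs match_game player1) (Start :: p)) /\
    match_ok (last Start p) (F player1 (Start :: p)) (F player2 (Start :: p)).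
  move=> /(pathP Start) Hp.
  (* The history [h] contains [Start] but [p] does not, hence the predecessor in the index; past the
     end of [p] the choice is [Sink]. *)
  pose mv h : {ffun 'I_3 -> bool * match_state} :=
    [ffun j => if j \in team then sigma j (map (@obs match_game j) h)
               else (true, nth Sink p (size h).-1)].
  have [|rho Hrho rhoS] := @free_Out_from _ _ _ Start (true, Sink) match_tab
    match_ob Start team sigma mv.
    by move=> h a aA; rewrite ffunE aA.
  have safe i : rho i != Bad by exact: (Hw player1 team1 Start erefl rho Hrho).
  have okS i : match_ok (rho i) (mv (mkseq rho i.+1) player1).1
                                (mv (mkseq rho i.+1) player2).1.
    by have := safe i.+1; rewrite rhoS /match_tab; case: ifP.
  have rhoE i : i <= size p -> rho i = nth Start (Start :: p) i.
    elim: i => [|i IHi] lei; first by case: Hrho.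
    rewrite rhoS /match_tab okS IHi ?(ltnW lei) // ffunE !inE size_mkseq /=.
    by rewrite (set_nth_default Start) // Hp.
  have hE : mkseq rho (size p).+1 = Start :: p.
    apply: (@eq_from_nth _ Start); first by rewrite size_mkseq.
    by move=> i; rewrite size_mkseq => lti; rewrite nth_mkseq // rhoE.
  split; first by rewrite -hE; apply: Out_obs_history Hrho.
  have := okS (size p); rewrite hE !ffunE team1 team2 rhoE //.
  by rewrite -[size p]/(size (Start :: p)).-1 nth_last.
have F_eq i m j : F player1 (word i.+1 m j.+1) = F player2 (word i.+1 m j.+1).
  have [_] := play _ (path_eq i m j.+1).
  rewrite -[F player1 _]F_ob -[F player2 _]F_ob !word_eq.
  by rewrite /eq_path !last_cat last_nseqS /= => /eqP.
have F_shift i m j : F player1 (word i.+1 m j.+1) = F player2 (word i m.+2 j).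
  have [_] := play _ (path_shift i m j).
  rewrite -[F player1 _]F_ob -[F player2 _]F_ob word_shift1 word_shift2.
  rewrite /shift_path last_cat /= last_cat /=.
  by case: j => [|j]; rewrite ?last_nseqS /= => /eqP.
have F_blank m : F player2 (word 0 m.+1 0).
  have [_] := play _ (path_blank m.+1).
  rewrite -[F player1 _]F_ob -[F player2 _]F_ob !word_blank.
  by rewrite last_nseqS /= => /andP[].
have F_surplus i m : F player2 (word i.+1 m.+1 0) = false.
  have [_] := play _ (path_eq i m.+1 0).
  rewrite -[F player1 _]F_ob -[F player2 _]F_ob !word_eq.
  rewrite /eq_path cats0 last_cat last_nseqS /= => /andP[_].
  exact: negbTE.
(* Each round trades one A and one B for two C's by [F_shift] and returns to player 1 by [F_eq], so
   [m] must stay general. When the B's run out, [F_blank] or [F_surplus] tells whether an A is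
   left. *)
have F_match i m j : j <= i -> F player1 (word i.+1 m j.+1) = (i == j).
  elim: j i m => [|j IHj] [|i] m //; rewrite F_shift ?F_blank ?F_surplus //.
  by rewrite -F_eq ltnS => /IHj ->.
have [_ [K _ [t Ht]]] := Hsigma player1 team1.
pose o x := @obs match_game player1 x.
pose q i := foldl (trans t) (init t) (map o (Start :: nseq i.+1 AA)).
(* With no C in between, the answer to the last B depends only on [j] and on the memory [q i] after
   the A's. *)
have F_run i j : F player1 (word i.+1 0 j.+1) =
    (output t (foldl (trans t) (q i) (nseq j (o BB))) (o BB)).1.
  have [+ _] := play _ (path_eq i 0 j.+1).
  have -> : map o (Start :: eq_path i.+1 0 j.+1) =
      rcons (map o (Start :: nseq i.+1 AA) ++ nseq j (o BB)) (o BB).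
    by rewrite rcons_cat rcons_nseq /eq_path /= map_cat /= !map_nseq.
  move=> /Ht; rewrite foldl_cat -/(q i) => <-.
  by rewrite rcons_cat rcons_nseq /F /= map_cat /= !map_nseq.
have [i [j [ij _ qij]]] := ord_pigeonhole q (leqnn K).
(* As [q i = q j], the unbalanced word with [j.+1] A's and [i.+1] B's gets the same answer as the
   balanced one with [i.+1] of each. *)
have := F_match _ 0 _ (ltnW ij); rewrite F_run -qij -F_run F_match // eqxx.
by move=> /esym/eqP; lia.
Qed.

Theorem mainTheorem2 (L : logic) :
  [/\ strictly_included (sat_rel L Memoryless) (sat_rel L (Memory 2)),
      (forall k : nat, 2 <= k ->
        strictly_included (sat_rel L (Memory k)) (sat_rel L (Memory k.+1)) /\
        strictly_included (sat_rel L (Memory k)) (sat_rel L FiniteMemory))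
    & strictly_included (sat_rel L FiniteMemory) (sat_rel L Recall)].
Proof.
split=> [|k _|].
- apply: strict_inclusion => [G j f /Strat_memoryless1/Strat_memoryS //|].
  exists (chain_model 1), (Some ord0), setT, tt; split; first exact: chain_pos.
  move=> Hsat; apply: (@chain_neg 1); apply: satisfies_mono Hsat => j f.
  exact: Strat_memoryless1.
- split; apply: strict_inclusion.
  + by move=> G j f; apply: Strat_memoryS.
  + exists (chain_model k), (Some ord0), setT, tt.
    by split; [apply: chain_pos | apply: chain_neg].
  + by move=> G j f; apply: Strat_memory_finite.
  (* The game won with [k.+1] memory states also separates [k] states from finite memory. *)
  exists (chain_model k), (Some ord0), setT, tt; split; last exact: chain_neg.
  apply: satisfies_mono (@chain_pos k) => j f; exact: Strat_memory_finite.
- apply: strict_inclusion => [G j f|]; first exact: Strat_recall.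
  exists match_model, Start, team, tt.
  by split; [apply: match_pos | apply: match_neg].
Qed.
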